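(* Let $d=d(n)\ge 0$ be integers and $p=p(n)\in[0,1]$. There are random graph distributions on $n$ vertices with edge probability $p$ with the following properties. (i) There is a $d$-dependent random graph distribution (one for each $n$, not depending on $\varepsilon$) with the property that for each fixed $\varepsilon>0$, if $p<(1-\varepsilon)(d+1)\dfrac{\ln(n/\sqrt{d+1})}{n}$ and $d\ln(n)/n\to 0$ as $n\to\infty$, then the graph is almost surely not connected. (ii) There is a $d$-dependent random graph distribution (namely, the Erdős–Rényi random graph) such that for any function $f(n)\to\infty$, if $p>\dfrac{\ln(n)+f(n)}{n}$, then the graph is almost surely connected.
   Context: A dependency graph for a finite family of random variables $(X_i)_{i\in I}$ is a (simple, undirected) graph on vertex set $I$ such that each $X_i$ is independent of the family of all $X_j$ ($j\ne i$) with $j$ not adjacent to $i$ (the notion used in the Lovász local lemma and Janson's inequality). The variables are $d$-locally dependent if they have a dependency graph of maximum degree at most $d$. A $d$-dependent random graph distribution $G_{n,p,d}$ is any probability distribution on simple graphs on $n$ (labelled) vertices such that each of the $\binom n2$ potential edges is present with probability exactly $p$, and the indicator variables of the edges are $d$-locally dependent. The Erdős–Rényi random graph is the distribution on graphs on $n$ vertices in which each edge is present independently with probability $p$. The parameters $p$ and $d$ may depend on $n$. An event happens almost surely if its probability tends to $1$ as $n\to\infty$. $\ln$ is the natural logarithm. *)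

(* Defs.v *)
From HB Require Import structures.
From mathcomp Require Import all_boot all_order all_algebra.
From mathcomp Require Import all_classical all_reals all_analysis.

Set Implicit Arguments.
Unset Strict Implicit.
Unset Printing Implicit Defensive.

Import Order.TTheory GRing.Theory Num.Theory.
Import numFieldNormedType.Exports.
Local Open Scope ring_scope.

(* A potential edge is an unordered pair of distinct vertices, and a simple
   graph on V is an arbitrary set of potential edges. *)
Definition edge (V : finType) : finType := {e : {set V} | #|e| == 2}.
Definition sgraph (V : finType) : finType := {set edge V}.

Definition adj (V : finType) (G : sgraph V) : rel V :=
  fun x y => [exists e : edge V, (e \in G) && (val e == [set x; y]%SET)].

Definition degree (V : finType) (G : sgraph V) (x : V) : nat :=
  #|[set y | adj G x y]%SET|.

(* The graph with no vertices counts as connected. *)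
Definition connected_graph (V : finType) (G : sgraph V) : bool :=
  [forall x, forall y, connect (adj G) x y].

(* A probability distribution on a finite type is given by its mass function. *)
Definition is_distribution (R : realType) (T : finType) (mu : T -> R) : Prop :=
  (forall w, 0 <= mu w) /\ \sum_(w : T) mu w = 1.

Definition Pr (R : realType) (T : finType) (mu : T -> R) (A : {set T}) : R :=
  \sum_(w in A) mu w.

Definition independent_rv (R : realType) (T : finType) (mu : T -> R)
    (A B : finType) (X : T -> A) (Y : T -> B) : Prop :=
  forall (E : {set A}) (F : {set B}),
    Pr mu [set w | (X w \in E) && (Y w \in F)]%SET =
    Pr mu [set w | X w \in E]%SET * Pr mu [set w | Y w \in F]%SET.

(* The family (X_j), j in J, as a single random variable. *)
Definition joint_rv (T I A : finType) (X : I -> T -> A) (J : {set I}) (w : T) :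
    {ffun {j : I | j \in J} -> A} :=
  [ffun j => X (val j) w].

Definition dependency_graph (R : realType) (T : finType) (mu : T -> R)
    (I A : finType) (X : I -> T -> A) (D : sgraph I) : Prop :=
  forall i : I,
    independent_rv mu (X i)
      (joint_rv X [set j | (j != i) && ~~ adj D i j]%SET).

Definition locally_dependent (R : realType) (T : finType) (mu : T -> R)
    (d : nat) (I A : finType) (X : I -> T -> A) : Prop :=
  exists D : sgraph I,
    dependency_graph mu X D /\ forall i : I, (degree D i <= d)%N.

Definition edge_indicator (V : finType) (e : edge V) (G : sgraph V) : bool :=
  e \in G.

Definition dependent_random_graph (R : realType) (n : nat) (p : R) (d : nat)
    (mu : sgraph 'I_n -> R) : Prop :=
  [/\ is_distribution mu,
      forall e : edge 'I_n, Pr mu [set G | edge_indicator e G]%SET = p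
    & locally_dependent mu d (@edge_indicator 'I_n)].

Definition erdos_renyi (R : realType) (n : nat) (p : R) (G : sgraph 'I_n) : R :=
  \prod_(e : edge 'I_n) (if e \in G then p else 1 - p).

(* The event E_n has probability tending to 1 under mu_n. *)
Definition almost_surely (R : realType) (mu : forall n, sgraph 'I_n -> R)
    (E : forall n, {set sgraph 'I_n}) : Prop :=
  ((fun n => Pr (mu n) (E n)) @ \oo --> (1 : R))%classic.

(* Main.v *)
(** Colour the potential edges so that every colour class has at most d + 1
    elements, keep each colour independently with probability p, and retain the
    edges whose colour is kept: this gives a d-dependent random graph, with
    dependency graph "same colour".  Colouring by the identity gives the
    Erdos-Renyi graph.

    (i) With k = d + 1, take m = n / (k ln n) blocks of t = sqrt k vertices.  All
    edges between two given blocks (or inside one block) share a colour, and the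
    edges from a block vertex to the remaining vertices are coloured in stars of
    size k.  Then a block vertex sees only m + n/k + 1 colours, and vertices of
    different blocks have at most one colour in common, so a second moment
    argument yields an isolated vertex.  The choice of m, which does not depend on
    epsilon, makes m tend to infinity while (1 - p)^m stays bounded below.

    (ii) Union bound over the cuts (S, complement of S) with |S| = k <= n/2, using
    (k/n) ln n <= ln k + 1 and k^k <= e^k k!, so that each k contributes at most
    exp(2 - f/2)^k. *)

Require Import Defs.
From HB Require Import structures.
From mathcomp Require Import all_boot all_order all_algebra.
From mathcomp Require Import all_classical all_reals all_analysis.
From mathcomp Require Import zify ring lra.

Set Implicit Arguments.
Unset Strict Implicit.
Unset Printing Implicit Defensive.

Import Order.TTheory GRing.Theory Num.Theory.
Import numFieldNormedType.Exports.
Local Open Scope ring_scope.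

(** * Random subsets from independent colours *)

Definition bernoulli_subset (R : realType) (L : finType) (p : R)
    (w : {set L}) : R :=
  \prod_l (if l \in w then p else 1 - p).

Definition colour_pullback (E L : finType) (g : E -> L) (w : {set L}) : {set E} :=
  [set e | g e \in w]%SET.

(** This is the image of the Bernoulli measure under [colour_pullback g]: elements of equal colour
    are kept or dropped together. *)
Definition coloured_random_subset (R : realType) (E L : finType) (g : E -> L)
    (p : R) (G : {set E}) : R :=
  \sum_(w | colour_pullback g w == G) bernoulli_subset p w.

Section Bernoulli.
Variables (R : realType) (L : finType) (p : R).
Local Notation mu := (@bernoulli_subset R L p).

Lemma bernoulli_subset_ge0 (w : {set L}) : 0 <= p <= 1 -> 0 <= mu w.
Proof.
by move=> /andP[p0 p1]; apply: prodr_ge0 => l _; case: ifP; rewrite ?subr_ge0.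
Qed.

Lemma sum_bernoulli_subset : \sum_w mu w = 1.
Proof.
rewrite /bernoulli_subset -(bigA_distr _ _ (fun=> p) (fun=> 1 - p)).
by rewrite big1 //= => l _; rewrite addrC subrK.
Qed.

Lemma Pr_bernoulli_setT : Pr mu [set: {set L}] = 1.
Proof.
by rewrite /Pr -[RHS]sum_bernoulli_subset; apply: eq_bigl => w; rewrite inE.
Qed.

(** The hypothesis says that [B] ignores the colour [l]. The weight of [w] is a factor for [l] times
    [W w], and adding [l] maps the sets without [l] bijectively onto those with [l] while preserving
    [W] and [B]. *)
Lemma Pr_bernoulli_mem (l : L) (B : {set {set L}}) :
  (forall w : {set L}, (w :\ l \in B)%SET = (w \in B)) ->
  Pr mu [set w : {set L} | (l \in w) && (w \in B)]%SET = p * Pr mu B.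
Proof.
move=> hB.
pose W (w : {set L}) := \prod_(i | i != l) (if i \in w then p else 1 - p).
have muE w : mu w = (if l \in w then p else 1 - p) * W w.
  by rewrite /bernoulli_subset (bigD1 l).
have WU (w : {set L}) : W (l |: w)%SET = W w.
  by apply: eq_bigr => i il; rewrite !inE (negPf il).
have hBU (w : {set L}) : (l |: w \in B)%SET = (w \in B).
  rewrite -(hB (l |: w)%SET) -[RHS]hB; congr (_ \in B).
  by apply/setP => i; rewrite !inE; case: eqP.
have in_part (P : pred {set L}) :
    \sum_(w : {set L} | (l \in w) && P w) mu w
      = \sum_(w : {set L} | (l \notin w) && P (l |: w)%SET) p * W w.
  rewrite (reindex_onto (fun w => l |: w)%SET (fun w => w :\ l)%SET); last first.
    by move=> w /andP[lw _]; rewrite finset.setD1K.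
  apply: eq_big => [w|w].
    rewrite !inE eqxx /=; have [lw|lw] := boolP (l \in w).
      apply/negbTE/negP => /andP[_ /eqP /setP /(_ l)].
      by rewrite !inE eqxx lw.
    by rewrite finset.setU1K ?eqxx ?andbT.
  by move=> _; rewrite muE !inE eqxx WU.
pose Z := \sum_(w : {set L} | (l \notin w) && (w \in B)) W w.
have inE' : \sum_(w : {set L} | (l \in w) && (w \in B)) mu w = p * Z.
  by rewrite in_part mulr_sumr; apply: eq_bigl => w; rewrite hBU.
have outE : \sum_(w : {set L} | (l \notin w) && (w \in B)) mu w = (1 - p) * Z.
  by rewrite mulr_sumr; apply: eq_bigr => w /andP[/negPf lw _]; rewrite muE lw.
have -> : Pr mu B = p * Z + (1 - p) * Z.
  rewrite -inE' -outE /Pr (bigID (fun w : {set L} => l \in w)) /=.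
  by congr (_ + _); apply: eq_bigl => w; rewrite andbC.
rewrite (_ : Pr _ _ = p * Z); first by ring.
by rewrite -inE'; apply: eq_bigl => w; rewrite inE.
Qed.

Lemma Pr_bernoulli_notin (l : L) (B : {set {set L}}) :
  (forall w : {set L}, (w :\ l \in B)%SET = (w \in B)) ->
  Pr mu [set w : {set L} | (l \notin w) && (w \in B)]%SET = (1 - p) * Pr mu B.
Proof.
move=> hB; rewrite mulrBl mul1r -(Pr_bernoulli_mem hB).
apply/eqP; rewrite eq_sym subr_eq addrC; apply/eqP.
rewrite [LHS](bigID (fun w : {set L} => l \in w)) /=.
by congr (_ + _); apply: eq_bigl => w; rewrite inE andbC.
Qed.

Lemma indep_bernoulli_mem (l : L) (S : {set bool}) (B : {set {set L}}) :
  (forall w : {set L}, (w :\ l \in B)%SET = (w \in B)) ->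
  Pr mu [set w : {set L} | ((l \in w) \in S) && (w \in B)]%SET =
  Pr mu [set w : {set L} | (l \in w) \in S]%SET * Pr mu B.
Proof.
pose c : R := (if true \in S then p else 0) + (if false \in S then 1 - p else 0).
have main (C : {set {set L}}) :
    (forall w : {set L}, (w :\ l \in C)%SET = (w \in C)) ->
    Pr mu [set w : {set L} | ((l \in w) \in S) && (w \in C)]%SET = c * Pr mu C.
  move=> hC; rewrite mulrDl [LHS](bigID (fun w : {set L} => l \in w)) /=.
  congr (_ + _); case: ifP => hS.
  - rewrite -(Pr_bernoulli_mem hC); apply: eq_bigl => w.
    by rewrite !inE; case: (l \in w); rewrite ?hS ?andbF ?andbT.
  - rewrite mul0r big1 // => w; rewrite !inE.
    by case: (l \in w); rewrite ?hS ?andbF.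
  - rewrite -(Pr_bernoulli_notin hC); apply: eq_bigl => w.
    by rewrite !inE; case: (l \in w); rewrite ?hS ?andbF ?andbT.
  - rewrite mul0r big1 // => w; rewrite !inE.
    by case: (l \in w); rewrite ?hS ?andbF.
move=> hB; rewrite main //; congr (_ * _).
(* Taking [C] to be the whole space identifies [c] as the probability of the event on [l] alone. *)
have := main [set: {set L}]; rewrite Pr_bernoulli_setT mulr1 => <-.
  by apply: eq_bigl => w; rewrite !inE andbT.
by move=> w; rewrite !inE.
Qed.

Lemma Pr_bernoulli_disjoint (A : {set L}) :
  Pr mu [set w : {set L} | [disjoint A & w]]%SET = (1 - p) ^+ #|A|.
Proof.
move: {2 3}#|A| (erefl #|A|) => m; elim: m A => [|m IH] A mA.
  rewrite (cards0_eq mA) expr0 -Pr_bernoulli_setT; apply: eq_bigl => w.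
  by rewrite !inE finset.disjoints_subset finset.sub0set.
have [A0|[l lA]] := set_0Vmem A; first by rewrite A0 cards0 in mA.
have mAl : #|(A :\ l)%SET| = m by move: mA; rewrite (cardsD1 l A) lA => -[].
rewrite exprS -(IH _ mAl) -(Pr_bernoulli_notin (l := l)).
  apply: eq_bigl => w; rewrite !inE.
  by rewrite !finset.disjoints_subset -{1}(finset.setD1K lA) finset.subUset finset.sub1set inE.
move=> w; rewrite !inE !finset.disjoints_subset; apply/fintype.subsetP/fintype.subsetP => h i.
  by move=> /[dup] /h; rewrite !inE negb_and negbK => /orP[->|].
by move=> /h; rewrite !inE negb_and negbK => ->; rewrite orbT.
Qed.

End Bernoulli.

Section Coloured.
Variables (R : realType) (E L : finType) (g : E -> L) (p : R).
Local Notation mu := (coloured_random_subset g p).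

Lemma Pr_coloured (A : {set {set E}}) :
  Pr mu A = Pr (bernoulli_subset p) [set w : {set L} | colour_pullback g w \in A]%SET.
Proof.
rewrite /Pr (partition_big (colour_pullback g) (fun G => G \in A)) /=; last first.
  by move=> w; rewrite inE.
apply: eq_bigr => G GA; apply: eq_bigl => w; rewrite inE.
by case: eqP => [->|]; rewrite ?GA ?andbF.
Qed.

Lemma coloured_distribution : 0 <= p <= 1 -> is_distribution mu.
Proof.
move=> p01; split=> [G|]; first by apply: sumr_ge0 => w _; exact: bernoulli_subset_ge0.
have := Pr_coloured [set: {set E}]; rewrite /Pr.
under eq_bigl => G do rewrite inE.
move=> ->; rewrite -(Pr_bernoulli_setT L p); apply: eq_bigl => w.
by rewrite !inE.
Qed.

Definition same_colour_graph : sgraph E :=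
  [set f : edge E | [forall e1 in val f, forall e2 in val f, g e1 == g e2]]%SET.

Lemma adj_same_colour (i j : E) :
  adj same_colour_graph i j = (j != i) && (g j == g i).
Proof.
apply/existsP/andP => [[f /andP[]]|[ji /eqP gij]].
  rewrite inE => /forall_inP h /eqP fE.
  have := valP f; rewrite /= fE cards2 eqSS eqb1 eq_sym => -> /=; split=> //.
  have := h j; rewrite fE !inE eqxx orbT => /(_ isT) /forall_inP /(_ i).
  by rewrite !inE eqxx => /(_ isT).
have h : #|[set i; j]%SET| == 2 by rewrite cards2 (eq_sym i) ji.
exists (Sub [set i; j]%SET h); rewrite inE SubK eqxx andbT.
apply/forall_inP => e1; rewrite !inE => e1E.
apply/forall_inP => e2; rewrite !inE => e2E.
by case/orP: e1E => /eqP ->; case/orP: e2E => /eqP ->; rewrite ?gij.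
Qed.

End Coloured.

(** A non-neighbour of [i] in the same-colour graph has a colour other than [g i], so the joint
    indicator of all of them ignores [g i] and is independent of edge [i]. The neighbours of [i] are
    its colour class without [i], which turns the class bound d + 1 into degree at most d. *)
Lemma coloured_dependent_random_graph (R : realType) (n : nat) (L : finType)
    (g : edge 'I_n -> L) (p : R) (d : nat) :
  0 <= p <= 1 -> (forall l, (#|[set e | g e == l]%SET| <= d.+1)%N) ->
  dependent_random_graph p d (coloured_random_subset g p).
Proof.
move=> p01 hd.
have hT (l : L) (w : {set L}) :
    (w :\ l \in [set: {set L}])%SET = (w \in [set: {set L}]%SET).
  by rewrite !inE.
have marginal (e : edge 'I_n) :
    Pr (coloured_random_subset g p) [set G | edge_indicator e G]%SET = p.
  rewrite Pr_coloured -[RHS]mulr1 -(Pr_bernoulli_setT L p).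
  rewrite -(Pr_bernoulli_mem p (hT (g e))).
  by apply: eq_bigl => w; rewrite !inE /edge_indicator inE andbT.
split=> //; first exact: coloured_distribution.
exists (same_colour_graph g); split; last first.
  move=> i; rewrite -ltnS; apply: leq_trans (hd (g i)).
  rewrite (cardsD1 i) inE eqxx ltnS; apply: subset_leq_card.
  by apply/fintype.subsetP => j; rewrite !inE adj_same_colour.
move=> i S F; rewrite !Pr_coloured.
pose J := [set j | (j != i) && ~~ adj (same_colour_graph g) i j]%SET.
pose B := [set w : {set L} |
  joint_rv (@edge_indicator 'I_n) J (colour_pullback g w) \in F]%SET.
have hB (w : {set L}) : (w :\ g i \in B)%SET = (w \in B).
  rewrite !inE; congr (_ \in F); apply/ffunP => -[j jJ]; rewrite !ffunE /=.
  move: jJ; rewrite inE adj_same_colour /edge_indicator !inE => /andP[-> /=].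
  by case: (g j == g i).
have := indep_bernoulli_mem p S hB.
by congr (_ = _ * _); apply: eq_bigl => w; rewrite !inE /edge_indicator ?inE.
Qed.

Lemma erdos_renyiE (R : realType) (n : nat) (p : R) (G : sgraph 'I_n) :
  coloured_random_subset id p G = erdos_renyi p G.
Proof.
rewrite /coloured_random_subset (eq_bigl (pred1 G)) ?big_pred1_eq // => w.
by congr (_ == G); apply/setP => e; rewrite inE.
Qed.

(** * Second moment *)

Section SecondMoment.
Variables (R : realType) (L : finType) (p : R).
Hypothesis p01 : 0 <= p < 1.
Local Notation mu := (@bernoulli_subset R L p).

Lemma expectation_disjoint (A : {set L}) :
  \sum_w mu w * [disjoint A & w]%:R = (1 - p) ^+ #|A|.
Proof.
rewrite -Pr_bernoulli_disjoint /Pr [RHS]big_mkcond /=; apply: eq_bigr => w _.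
by rewrite inE; case: ifP; rewrite ?mulr1 ?mulr0.
Qed.

(** Both indicators equal 1 exactly when [w] misses the union, which has 2M - |A ∩ B| elements. *)
Lemma covariance_disjoint (A B : {set L}) (M : nat) : #|A| = M -> #|B| = M ->
  \sum_w mu w * (([disjoint A & w]%:R - (1 - p) ^+ M) *
                 ([disjoint B & w]%:R - (1 - p) ^+ M))
  = ((1 - p) ^+ M) ^+ 2 * ((1 - p)^-1 ^+ #|(A :&: B)%SET| - 1).
Proof.
move=> hA hB; set P := (1 - p) ^+ M.
have q0 : 1 - p != 0 by case/andP: p01 => _; lra.
have AB (w : {set L}) : [disjoint A & w]%:R * [disjoint B & w]%:R
    = [disjoint (A :|: B)%SET & w]%:R :> R.
  by rewrite -natrM mulnb !finset.disjoints_subset finset.subUset.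
transitivity (\sum_w (mu w * [disjoint (A :|: B)%SET & w]%:R
    - P * (mu w * [disjoint A & w]%:R) - P * (mu w * [disjoint B & w]%:R)
    + P * P * mu w)).
  by apply: eq_bigr => w _; rewrite -AB; ring.
rewrite big_split /= !sumrB -!mulr_sumr !expectation_disjoint.
rewrite sum_bernoulli_subset hA hB -/P.
suff -> : (1 - p) ^+ #|(A :|: B)%SET| = P ^+ 2 * (1 - p)^-1 ^+ #|(A :&: B)%SET|.
  by ring.
apply: (mulIf (expf_neq0 #|(A :&: B)%SET| q0)).
rewrite -exprD cardsUI hA hB exprVn mulfVK ?expf_neq0 //.
by rewrite exprD expr2.
Qed.

(** Chebyshev's inequality: if [w] meets every [A x], the centred count of missed sets equals -P|I|,
    so its square is P^2 |I|^2. The right-hand side is the variance of the count divided by P^2. *)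
Lemma second_moment_disjoint (I : finType) (A : I -> {set L}) (M : nat) :
  (forall x, #|A x| = M) ->
  Pr mu [set w : {set L} | [forall x, ~~ [disjoint A x & w]]]%SET * #|I|%:R ^+ 2
  <= \sum_x \sum_y ((1 - p)^-1 ^+ #|(A x :&: A y)%SET| - 1).
Proof.
move=> hA; have [p0 p1] := andP p01.
set P := (1 - p) ^+ M.
have P0 : 0 < P by rewrite exprn_gt0 // subr_gt0.
rewrite -(ler_pM2l (exprn_gt0 2 P0)) mulr_sumr.
under [leRHS]eq_bigr => x _.
  rewrite mulr_sumr.
  under eq_bigr => y _ do rewrite -(covariance_disjoint (hA x) (hA y)).
  over.
rewrite (_ : \sum__ _ = \sum_w mu w *
    (\sum_x ([disjoint A x & w]%:R - P)) ^+ 2); last first.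
  under eq_bigr => x _ do rewrite exchange_big /=.
  rewrite exchange_big /=; apply: eq_bigr => w _.
  rewrite expr2 mulr_suml mulr_sumr; apply: eq_bigr => x _.
  by rewrite -!mulr_sumr.
rewrite [leRHS](bigID (fun w : {set L} => [forall x, ~~ [disjoint A x & w]])) /=.
rewrite -[leLHS]addr0; apply: lerD; last first.
  apply: sumr_ge0 => w _; apply: mulr_ge0; last exact: sqr_ge0.
  by apply: bernoulli_subset_ge0; rewrite p0 ltW.
rewrite /Pr mulrCA mulr_suml le_eqVlt; apply/orP; left; apply/eqP.
apply: eq_big => [w|w]; rewrite !inE // => /forallP h; congr (_ * _).
rewrite (eq_bigr (fun=> - P)); last by move=> x _; rewrite (negPf (h x)) sub0r.
by rewrite sumr_const mulNrn sqrrN -[P *+ _]mulr_natr exprMn.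
Qed.

End SecondMoment.

(** * The block colouring *)

Section BlockColouring.
Variables (n k m t : nat).

(** [inl (i, j)] stands for a pair of blocks, [inr (u, c)] for a star with centre u. All these
    numbers are at most n, so [inord] into ['I_n.+1] loses nothing. *)
Local Notation block_colours := (('I_n.+1 * 'I_n.+1) + ('I_n.+1 * 'I_n.+1))%type.

(** An edge is an unordered pair; its maximum and its sum recover both endpoints without a
    choice. *)
Definition edge_hi (e : edge 'I_n) : nat := \max_(x in val e) x.
Definition edge_lo (e : edge 'I_n) : nat := (\sum_(x in val e) x - edge_hi e)%N.

Lemma edge_lo_hiP (e : edge 'I_n) :
  exists x y : 'I_n,
    [/\ val e = [set x; y]%SET, (x < y)%N, edge_lo e = x & edge_hi e = y].
Proof.
have hiE (x y : 'I_n) : x != y -> \max_(z in [set x; y]%SET) z = maxn x y :> nat.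
  by move=> xy; rewrite big_setU1 ?inE //= big_set1.
have sumE (x y : 'I_n) : x != y -> (\sum_(z in [set x; y]%SET) z = x + y)%N.
  by move=> xy; rewrite big_setU1 ?inE //= big_set1.
have /cards2P[x [y [xy eE]]] := valP e.
wlog ltxy : x y xy eE / (x < y)%N.
  move=> H; have := xy; rewrite neq_ltn => /orP[] h; first exact: (H x y).
  by apply: (H y x) => //; rewrite 1?eq_sym // eE finset.setUC.
exists x, y; rewrite /edge_lo /edge_hi eE hiE // sumE //.
by split=> //; lia.
Qed.

(* The block vertices are those below m * t, and u %/ t is the block of u.  With
   u < v, an edge uv with v outside the blocks belongs to the star centred at u
   whose leaves are the vertices w >= m * t with w %/ k = v %/ k. *)
Definition block_colour (e : edge 'I_n) :
    block_colours :=
  if (edge_hi e < m * t)%N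
  then inl (inord (edge_lo e %/ t), inord (edge_hi e %/ t))
  else inr (inord (edge_lo e), inord (edge_hi e %/ k)).

Lemma edge_lo_hi_inj (e e' : edge 'I_n) :
  edge_lo e = edge_lo e' -> edge_hi e = edge_hi e' -> e = e'.
Proof.
have [x [y [eE _ -> ->]]] := edge_lo_hiP e.
have [x' [y' [eE' _ -> ->]]] := edge_lo_hiP e'.
by move=> /ord_inj xx /ord_inj yy; apply: val_inj; rewrite /= eE eE' xx yy.
Qed.

Lemma edge_hi_lt (e : edge 'I_n) : (edge_hi e < n)%N.
Proof. by have [x [y [_ _ _ ->]]] := edge_lo_hiP e. Qed.

Lemma edge_lo_lt (e : edge 'I_n) : (edge_lo e < n)%N.
Proof. by have [x [y [_ _ -> _]]] := edge_lo_hiP e. Qed.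

Lemma inord_inj (a b : nat) :
  (a <= n)%N -> (b <= n)%N -> inord a = inord b :> 'I_n.+1 -> a = b.
Proof. by move=> an bn /(congr1 val); rewrite /= !inordK. Qed.

(** In a class [inl] the quotients by t of both endpoints are fixed, so the two residues mod t
    determine the edge, leaving at most t * t edges. In a class [inr] the lower endpoint is fixed
    and the residue mod k of the upper one determines the edge. *)
Lemma card_block_colour (l : block_colours) :
  (0 < t)%N -> (t * t <= k)%N ->
  (#|[set e | block_colour e == l]%SET| <= k)%N.
Proof.
move=> t0 tk; have k0 : (0 < k)%N by apply: leq_trans tk; rewrite muln_gt0 t0.
have le_div a (e : edge 'I_n) : (edge_hi e %/ a <= n)%N /\ (edge_lo e %/ a <= n)%N.
  by split; apply: leq_trans (leq_div _ _) (ltnW _);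
    [exact: edge_hi_lt | exact: edge_lo_lt].
have div_mod_inj a b c : (b %/ a = c %/ a -> b %% a = c %% a -> b = c)%N.
  by move=> h1 h2; rewrite (divn_eq b a) h1 h2 -divn_eq.
case: l => -[l1 l2].
  pose f (e : edge 'I_n) : 'I_t.-1.+1 * 'I_t.-1.+1 :=
    (inord (edge_lo e %% t), inord (edge_hi e %% t)).
  have mod_t a : (a %% t < t.-1.+1)%N by rewrite prednK // ltn_pmod.
  apply: leq_trans (leq_card_in f _ _) _; last first.
    by rewrite card_prod !card_ord prednK.
  move=> e e'; rewrite !inE /block_colour.
  case: ifP => // _ /eqP[<- <-]; case: ifP => // _ /eqP[].
  move=> /inord_inj h1 /inord_inj h2 [].
  move=> /(congr1 val) /=; rewrite !inordK // => h3.
  move=> /(congr1 val) /=; rewrite !inordK // => h4.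
  apply: edge_lo_hi_inj; apply: (div_mod_inj t) => //; apply/esym.
    by apply: h1; case: (le_div t e); case: (le_div t e').
  by apply: h2; case: (le_div t e); case: (le_div t e').
pose f (e : edge 'I_n) : 'I_k.-1.+1 := inord (edge_hi e %% k).
have mod_k a : (a %% k < k.-1.+1)%N by rewrite prednK // ltn_pmod.
apply: leq_trans (leq_card_in f _ _) _; last by rewrite card_ord prednK.
move=> e e'; rewrite !inE /block_colour.
case: ifP => // _ /eqP[<- <-]; case: ifP => // _ /eqP[].
move=> /inord_inj h1 /inord_inj h2.
move=> /(congr1 val) /=; rewrite !inordK // => h3.
apply: edge_lo_hi_inj; first by apply/esym/h1; exact/ltnW/edge_lo_lt.
apply: (div_mod_inj k) => //; apply/esym; apply: h2.
  by case: (le_div k e').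
by case: (le_div k e).
Qed.

Hypotheses (k0 : (0 < k)%N) (t0 : (0 < t)%N) (m0 : (0 < m)%N) (mtn : (m * t <= n)%N).

(* Contains all colours of edges at the vertex x.1 * t + x.2; it has the same
   cardinality for every x, which simplifies the second moment. *)
Definition incident_colours (x : 'I_m * 'I_t) :
    {set block_colours} :=
  ([set inl (inord (minn x.1 i), inord (maxn x.1 i)) | i : 'I_m]
   :|: [set inr (inord (x.1 * t + x.2), inord c) | c : 'I_(n %/ k).+1])%SET.

Lemma block_le (i : 'I_m) : (i < n)%N.
Proof.
apply: leq_trans (ltn_ord i) (leq_trans _ mtn); exact: leq_pmulr.
Qed.

Lemma block_vertex_lt (x : 'I_m * 'I_t) : (x.1 * t + x.2 < m * t)%N.
Proof.
case: x => i j /=; apply: (@leq_trans (i * t + t)%N); first by rewrite ltn_add2l.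
by rewrite addnC -mulSn leq_mul2r ltn_ord orbT.
Qed.

Lemma inl_inord_inj (a b c d : nat) :
  (a <= n)%N -> (b <= n)%N -> (c <= n)%N -> (d <= n)%N ->
  inl (inord a, inord b) = inl (inord c, inord d)
    :> block_colours -> a = c /\ b = d.
Proof. by move=> ? ? ? ? [] /inord_inj h1 /inord_inj h2; split; auto. Qed.

Lemma minmax_le (i j : 'I_m) : (minn i j <= n)%N /\ (maxn i j <= n)%N.
Proof. by have := block_le i; have := block_le j; lia. Qed.

Lemma card_incident_colours (x : 'I_m * 'I_t) :
  #|incident_colours x| = (m + (n %/ k).+1)%N.
Proof.
rewrite cardsU; set I0 := (_ :&: _)%SET; have -> : I0 = finset.set0.
  apply/setP => l; rewrite !inE; apply/andP => -[/imsetP[i _ ->] /imsetP[c _]].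
  by [].
rewrite cards0 subn0 !card_imset ?card_ord // => [i c|i c] /=.
  move=> [] /inord_inj h; apply/ord_inj/h.
    by rewrite -ltnS (leq_trans (ltn_ord i)) // ltnS leq_div.
  by rewrite -ltnS (leq_trans (ltn_ord c)) // ltnS leq_div.
have [[mi Mi] [mc Mc]] := (minmax_le x.1 i, minmax_le x.1 c).
by move=> /(inl_inord_inj mi Mi mc Mc)[h1 h2]; apply: ord_inj; lia.
Qed.

(** A star colour records its centre, so distinct vertices share none. Two vertices of one block can
    share the m block colours; vertices of different blocks share only the colour of that pair of
    blocks. *)
Lemma card_incident_coloursI (x y : 'I_m * 'I_t) : x != y ->
  (#|(incident_colours x :&: incident_colours y)%SET|
   <= if x.1 == y.1 then m else 1)%N.
Proof.
move=> xy.
have vertex_inj : (x.1 * t + x.2)%N != (y.1 * t + y.2)%N.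
  apply: contra xy => /eqP h; case: x y h => [i j] [i' j'] /= h.
  have h1 : (i = i' :> nat)%N.
    by have := congr1 (divn^~ t) h; rewrite /= !divnMDl // !divn_small // !addn0.
  by apply/eqP; congr pair; apply: ord_inj => //; move: h; rewrite h1 => /addnI.
have vx (z : 'I_m * 'I_t) : (z.1 * t + z.2 <= n)%N.
  by apply: ltnW; apply: leq_trans mtn; exact: block_vertex_lt.
have sub l : l \in (incident_colours x :&: incident_colours y)%SET ->
    exists i i' : 'I_m, [/\ l = inl (inord (minn x.1 i), inord (maxn x.1 i)),
      minn x.1 i = minn y.1 i' & maxn x.1 i = maxn y.1 i'].
  rewrite !inE => /andP[/orP[]/imsetP[i _ ->] /orP[]/imsetP[i' _]] //.
    have [[mi Mi] [mc Mc]] := (minmax_le x.1 i, minmax_le y.1 i').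
    by move=> /(inl_inord_inj mi Mi mc Mc)[h1 h2]; exists i, i'.
  by move=> [] /inord_inj h _; case/eqP: vertex_inj; apply: h.
case: eqP => xy1.
  pose f (i : 'I_m) : block_colours := inl (inord (minn x.1 i), inord (maxn x.1 i)).
  apply: leq_trans (_ : #|[set f i | i : 'I_m]%SET| <= _)%N.
    apply: subset_leq_card; apply/fintype.subsetP => l /sub[i [_ [-> _ _]]].
    exact: (imset_f f).
  by apply: leq_trans (leq_imset_card _ _) _; rewrite card_ord.
rewrite -(cards1 (inl (inord (minn x.1 y.1), inord (maxn x.1 y.1))
    : block_colours)).
apply: subset_leq_card; apply/fintype.subsetP => l /sub[i [i' [-> h1 h2]]].
rewrite inE; have xy2 : (x.1 != y.1 :> nat) by apply/eqP => /ord_inj.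
by apply/eqP; congr (inl (inord _, inord _)); lia.
Qed.

Lemma isolated_disconnected (G : sgraph 'I_n) (x : 'I_n) : (1 < n)%N ->
  (forall e : edge 'I_n, x \in val e -> e \notin G) -> ~~ connected_graph G.
Proof.
move=> n1 h; have [y yx] : exists y : 'I_n, y != x.
  have h0 : (0 < n)%N by apply: ltnW.
  case: (eqVneq x (Ordinal h0)) => [->|]; first by exists (Ordinal n1).
  by rewrite eq_sym; exists (Ordinal h0).
apply/negP => /forallP /(_ x) /forallP /(_ y) /connectP[[|z s] /=].
  by move=> _ /eqP; rewrite (negPf yx).
move=> /andP[/existsP[e /andP[eG /eqP eE]] _] _.
by have := h e; rewrite /= eE !inE eqxx eG => /(_ isT).
Qed.

(** All edges at the block vertex have their colours in [incident_colours x]; if none of these is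
    kept, the vertex is isolated. *)
Lemma disjoint_incident_colours (x : 'I_m * 'I_t) (w : {set _}) : (1 < n)%N ->
  [disjoint incident_colours x & w] ->
  ~~ connected_graph (colour_pullback block_colour w).
Proof.
move=> n1 dis; have xn := leq_trans (block_vertex_lt x) mtn.
apply: (isolated_disconnected (x := Ordinal xn)) => // e xe; rewrite inE.
suff h : block_colour e \in incident_colours x by rewrite (disjointFr dis h).
have bm a : (a < m * t)%N -> (a %/ t < m)%N by move=> h; rewrite ltn_divLR.
have xdiv : ((x.1 * t + x.2) %/ t = x.1)%N.
  by rewrite divnMDl // divn_small // addn0.
have xmt := block_vertex_lt x.
move: xe; rewrite /block_colour.
have [u [v [eE uv -> ->]]] := edge_lo_hiP e; rewrite /= eE !inE.
case: ifP => vmt.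
  have umt := ltn_trans uv vmt.
  have div_le : (u %/ t <= v %/ t)%N by apply: leq_div2r; exact: ltnW.
  case/orP => /eqP h; apply/orP; left; apply/imsetP.
    exists (Ordinal (bm _ vmt)) => //=; rewrite -h /= xdiv in div_le *.
    by congr (inl (inord _, inord _)); lia.
  exists (Ordinal (bm _ umt)) => //=; rewrite -h /= xdiv in div_le *.
  by congr (inl (inord _, inord _)); lia.
(* Here v lies outside the blocks, so the block vertex must be u, the centre of the star. *)
move=> h; apply/orP; right; apply/imsetP.
have {h} ux : (u = x.1 * t + x.2 :> nat)%N.
  by case/orP: h => /eqP h; [rewrite -h|rewrite -h /= xmt in vmt].
have vk : (v %/ k < (n %/ k).+1)%N by rewrite ltnS leq_div2r // ltnW.
by exists (Ordinal vk) => //=; rewrite ux.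
Qed.

(** The three terms come from the pairs (x, y) in the second moment: equal vertices, vertices in the
    same block, and all pairs, which share at most one colour when the blocks differ. *)
Lemma Pr_connected_block_colour (R : realType) (p : R) : (1 < n)%N ->
  0 <= p < 1 ->
  Pr (coloured_random_subset block_colour p) [set G | connected_graph G]%SET
  <= (1 - p)^-1 ^+ (m + (n %/ k).+1) / (m * t)%:R
     + (1 - p)^-1 ^+ m / m%:R + ((1 - p)^-1 - 1).
Proof.
move=> n1 p01; have [p0 p1] := andP p01.
set M := (m + _)%N; set z := (1 - p)^-1.
have z1 : 1 <= z by rewrite invr_ge1 ?unitfE; lra.
have mt0 : (0 : R) < (m * t)%:R by rewrite ltr0n muln_gt0 m0.
have mR0 : (0 : R) < m%:R by rewrite ltr0n.
have tR0 : (0 : R) < t%:R by rewrite ltr0n.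
rewrite Pr_coloured.
apply: le_trans (_ : Pr (bernoulli_subset p)
  [set w : {set _} | [forall x, ~~ [disjoint incident_colours x & w]]]%SET <= _).
  rewrite /Pr [leLHS]big_mkcond [leRHS]big_mkcond /=; apply: ler_sum => w _.
  rewrite !inE; case: ifP => [conn|_]; last first.
    by case: ifP => // _; apply: bernoulli_subset_ge0; rewrite p0 ltW.
  rewrite ifT //; apply/forallP => x; apply: contraTN conn.
  exact: disjoint_incident_colours.
rewrite -(ler_pM2r (exprn_gt0 2 mt0)).
have -> : (m * t)%:R = #|{: 'I_m * 'I_t}|%:R :> R by rewrite card_prod !card_ord.
apply: le_trans (second_moment_disjoint p01 card_incident_colours) _.
rewrite card_prod !card_ord.
(* The three contributions are added rather than distinguished by cases, so that the double sum
   splits. *)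
apply: le_trans (_ : \sum_(x : 'I_m * 'I_t) \sum_(y : 'I_m * 'I_t)
  ((x == y)%:R * z ^+ M + (x.1 == y.1)%:R * z ^+ m + (z - 1)) <= _).
  apply: ler_sum => x _; apply: ler_sum => y _; rewrite -/z.
  have zX a : 0 <= z ^+ a by rewrite exprn_ge0 // (le_trans ler01).
  have [->|xy] := eqVneq x y.
    rewrite finset.setIid card_incident_colours -/M eqxx /=.
    by have := zX m; lra.
  have := card_incident_coloursI xy; rewrite /= mulr0n mul0r add0r.
  move: #|_| => c; case: eqP => _ hc.
    have h : z ^+ c <= z ^+ m by apply: ler_weXn2l.
    rewrite mulr1n mul1r.
    by move: (z ^+ c) (z ^+ m) h => a b h; lra.
  have h : z ^+ c <= z ^+ 1 by apply: ler_weXn2l.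
  by rewrite mulr0n mul0r add0r lerD2r.
have inner (x : 'I_m * 'I_t) : \sum_(y : 'I_m * 'I_t)
    ((x == y)%:R * z ^+ M + (x.1 == y.1)%:R * z ^+ m + (z - 1))
  = z ^+ M + t%:R * z ^+ m + (m * t)%:R * (z - 1).
  rewrite big_split /= sumr_const card_prod !card_ord big_split /= -!mulr_suml.
  rewrite -[(z - 1) *+ _]mulr_natl -[X in _ = X + _ + _]mul1r.
  congr (_ * _ + _ * _ + _).
    rewrite (bigD1 x) //= eqxx big1 ?addr0 // => y.
    by rewrite eq_sym => /negPf ->.
  rewrite -(pair_big xpredT xpredT
    (fun (i : 'I_m) (_ : 'I_t) => (x.1 == i)%:R : R)) /=.
  rewrite (bigD1 x.1) //= eqxx sumr_const card_ord big1 ?addr0 // => i.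
  by rewrite eq_sym => /negPf h; rewrite big1 // => j _; rewrite h.
under eq_bigr do rewrite inner.
rewrite sumr_const card_prod !card_ord -[leLHS]mulr_natl natrM.
rewrite le_eqVlt; apply/orP; left; apply/eqP.
by field; rewrite !gt_eqF.
Qed.

End BlockColouring.

(** * Connectivity of the Erdos-Renyi graph *)

Definition cut_edges (V : finType) (S : {set V}) : {set edge V} :=
  [set e : edge V |
     [exists u in S, exists v in ~: S, val e == [set u; v]%SET]]%SET.

(** The map (u, v) -> {u, v} is injective on the product of S and its complement, since membership
    in S tells the endpoints apart. *)
Lemma card_cut_edges (V : finType) (S : {set V}) :
  (#|S| * (#|V| - #|S|) <= #|cut_edges S|)%N.
Proof.
have -> : (#|V| - #|S| = #|(~: S)%SET|)%N by rewrite (cardsCs (~: S)) finset.setCK.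
rewrite -cardsX -(card_imset (mem (cut_edges S)) val_inj).
rewrite -(card_in_imset (f := fun uv : V * V => [set uv.1; uv.2]%SET)).
  apply: subset_leq_card; apply/fintype.subsetP => _ /imsetP[[u v] /= uv ->].
  move: uv; rewrite !inE /= => /andP[uS vS].
  have uv : u != v by apply: contraNneq vS => <-.
  have h : #|[set u; v]%SET| == 2 by rewrite cards2 uv.
  apply/imsetP; exists (Sub [set u; v]%SET h); last by rewrite SubK.
  rewrite inE; apply/exists_inP; exists u => //.
  by apply/exists_inP; exists v; rewrite ?inE ?SubK.
move=> [u v] [u' v']; rewrite !inE /= => /andP[uS vS] /andP[uS' vS'] E.
have /setP/(_ u) := E; have /setP/(_ v) := E; rewrite !inE !eqxx orbT /=.
have [vu' _|_ /=] := eqVneq v u'; first by rewrite vu' uS' in vS.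
move=> /esym/eqP ->.
have [uv' _|_ /=] := eqVneq u v'; first by rewrite -uv' uS in vS'.
by rewrite orbF => /esym/eqP ->.
Qed.

(** S is the component of some vertex or its complement, whichever has at most half of the
    vertices. *)
Lemma disconnected_cut (V : finType) (G : sgraph V) : ~~ connected_graph G ->
  exists S : {set V},
    [/\ (0 < #|S|)%N, (#|S|.*2 <= #|V|)%N & [disjoint cut_edges S & G]].
Proof.
rewrite /connected_graph negb_forall => /existsP[x].
rewrite negb_forall => /existsP[y nxy].
pose C := [set z | connect (adj G) x z]%SET.
have closedC u v : u \in C -> adj G u v -> v \in C.
  by rewrite !inE => xu uv; apply: connect_trans xu (connect1 uv).
have noedge (S : {set V}) : (S = C) \/ (S = ~: C)%SET -> [disjoint cut_edges S & G].
  move=> SC; rewrite disjoint_subset; apply/fintype.subsetP => e.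
  rewrite inE => /exists_inP[u uS /exists_inP[v vS /eqP eE]].
  rewrite inE; apply/negP => eG.
  have uv : adj G u v by apply/existsP; exists e; rewrite eG eE /=.
  have vu : adj G v u by apply/existsP; exists e; rewrite eG eE finset.setUC /=.
  move: uS vS; case: SC => ->; rewrite finset.in_setC.
    by move=> uC; rewrite (closedC u v).
  by rewrite finset.setCK => uC vC; move: uC; rewrite (closedC v u).
have [hC|hC] := leqP #|C|.*2 #|V|.
  exists C; split=> //; last by apply: noedge; left.
  by apply/card_gt0P; exists x; rewrite inE connect0.
exists (~: C)%SET; split; last by apply: noedge; right.
  by apply/card_gt0P; exists y; rewrite !inE.
by have := cardsC C; lia.
Qed.

Section ErdosRenyiConnectivity.
Variable R : realType.

(** The bound is (e n / k)^k: 'C(n, k) is at most n^k / k!, and k^k / k! is one term of the series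
    of e^k. *)
Lemma binom_le_expR (n k : nat) : (0 < k)%N -> (0 < n)%N ->
  'C(n, k)%:R <= expR (k%:R * ln n%:R + k%:R - k%:R * ln k%:R) :> R.
Proof.
move=> k0 n0; have kR0 : (0 : R) < k%:R by rewrite ltr0n.
have nR0 : (0 : R) < n%:R by rewrite ltr0n.
have fact0 : (0 : R) < k`!%:R by rewrite ltr0n fact_gt0.
rewrite expRD expRD expRN mulrC.
have expR_ln (a : R) (b : nat) : 0 < a -> expR (b%:R * ln a) = a ^+ b.
  by move=> a0; rewrite mulrC expRM_natr lnK.
rewrite !expR_ln //.
have choose : 'C(n, k)%:R * k`!%:R <= n%:R ^+ k :> R.
  rewrite -natrM bin_ffact -natrX ler_nat ffact_prod.
  rewrite -[in leqRHS](card_ord k) -prod_nat_const.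
  by apply: leq_prod => i _; exact: leq_subr.
have stirling : k%:R ^+ k / k`!%:R <= expR k%:R :> R.
  have := @expR_ge1Dxn R k%:R k.-1 (ltW kR0); rewrite prednK //.
  by apply: le_trans; rewrite lerDr.
rewrite ler_pdivlMl ?exprn_gt0 //.
rewrite ler_pdivrMr // in stirling.
have := ler_pM (ltW (exprn_gt0 k kR0)) _ stirling choose.
rewrite mulr_ge0 ?ler0n // => /(_ isT).
set a := k%:R ^+ k; set b := 'C(n, k)%:R; set c := k`!%:R.
set e := expR _; set N := n%:R ^+ k => h.
by rewrite -(ler_pM2r fact0) -/c -mulrA (le_trans h) // mulrAC [e * N]mulrC.
Qed.

(** With x = k/n <= 1/2, the exponent is k times ln n + 1 - ln k - pn(1 - x). The hypothesis on pn
    bounds the second factor by 1 - ln k + x ln n - f(1 - x), hence by 2 - f/2. *)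
Lemma cut_term_le (n k : nat) (p f : R) :
  (0 < k)%N -> (k.*2 <= n)%N -> 0 <= p <= 1 -> 0 <= f -> ln n%:R + f <= p * n%:R ->
  'C(n, k)%:R * (1 - p) ^+ (k * (n - k)) <= expR (2 - f / 2) ^+ k.
Proof.
move=> k0 kn /andP[p0 p1] f0 hp.
have n0 : (0 < n)%N by lia.
have kR0 : (0 : R) < k%:R by rewrite ltr0n.
have nR0 : (0 : R) < n%:R by rewrite ltr0n.
have h1 : (1 - p) ^+ (k * (n - k)) <= expR (- p * (k%:R * (n%:R - k%:R))).
  rewrite -natrB; last by lia.
  rewrite -natrM expRM_natr lerXn2r ?nnegrE ?subr_ge0 ?expR_ge0 //.
  exact: expR_ge1Dx.
apply: le_trans (ler_pM _ _ (binom_le_expR k0 n0) h1) _; rewrite ?ler0n //.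
  by rewrite exprn_ge0 // subr_ge0.
rewrite -expRD -expRM_natr ler_expR.
pose x : R := k%:R / n%:R.
have x0 : 0 < x by rewrite divr_gt0.
have xn : x * n%:R = k%:R by rewrite divfK ?gt_eqF.
have x2 : x <= 2^-1.
  by rewrite ler_pdivrMr // mulrC ler_pdivlMr // -natrM ler_nat; lia.
have lnk0 : 0 <= ln (k%:R : R) by apply: ln_ge0; rewrite ler1n.
(* Multiply ln(n/k) <= n/k by x, then use x ln k <= ln k. *)
have lnn : x * ln n%:R <= ln k%:R + 1.
  have h : ln (n%:R / k%:R) < n%:R / k%:R :> R.
    by apply: ln_sublinear; rewrite divr_gt0.
  rewrite ln_div ?posrE // in h.
  have := ltW h; rewrite -(ler_pM2l x0) [x * (_ / _)](_ : _ = 1); last first.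
    by rewrite /x; field; rewrite !gt_eqF.
  by nra.
have h2 : (ln n%:R + f) * (1 - x) <= p * n%:R * (1 - x).
  by rewrite ler_wpM2r //; lra.
have -> : - p * (k%:R * (n%:R - k%:R)) = - (k%:R * (p * n%:R * (1 - x))).
  by rewrite -[in RHS]xn -[in LHS]xn; ring.
have -> : k%:R * ln n%:R + k%:R - k%:R * ln k%:R - k%:R * (p * n%:R * (1 - x))
    = (ln n%:R + 1 - ln k%:R - p * n%:R * (1 - x)) * k%:R by ring.
rewrite ler_pM2r //; nra.
Qed.

Lemma Pr_disconnected_erdos_renyi (n : nat) (p f : R) :
  0 <= p <= 1 -> 0 <= f -> ln n%:R + f <= p * n%:R -> expR (2 - f / 2) <= 2^-1 ->
  Pr (@erdos_renyi R n p) [set G | ~~ connected_graph G]%SET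
  <= 2 * expR (2 - f / 2).
Proof.
move=> p01 f0 hp; set z := expR _ => z2; have [p0 p1] := andP p01.
have z0 : 0 < z by exact: expR_gt0.
pose P (S : {set 'I_n}) := (0 < #|S|)%N && (#|S|.*2 <= n)%N.
apply: (@le_trans _ _ (\sum_(S | P S)
    Pr (@erdos_renyi R n p) [set G : {set _} | [disjoint cut_edges S & G]]%SET)).
  rewrite /Pr; under [leRHS]eq_bigr => S _ do rewrite big_mkcond.
  rewrite exchange_big /= [leLHS]big_mkcond; apply: ler_sum => G _.
  have mu0 : 0 <= erdos_renyi p G by exact: bernoulli_subset_ge0.
  have nn S : 0 <= (if G \in [set G : {set _} | [disjoint cut_edges S & G]]%SET
      then erdos_renyi p G else 0) by case: ifP.
  rewrite inE; case: ifP => [/disconnected_cut[S [S0 S2 dis]]|_]; last first.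
    by apply: sumr_ge0 => S _.
  rewrite card_ord in S2.
  rewrite (bigD1 S) /=; last by rewrite /P S0 S2.
  by rewrite inE dis lerDl; apply: sumr_ge0 => S' _.
apply: (@le_trans _ _ (\sum_(S | P S) (1 - p) ^+ (#|S| * (n - #|S|)))).
  apply: ler_sum => S _.
  rewrite (Pr_bernoulli_disjoint p (cut_edges S)).
  have := card_cut_edges S; rewrite card_ord => h.
  by apply: ler_wiXn2l => //; rewrite ?subr_ge0 ?gerBl.
(* The sets S are grouped by size; each size k contributes at most z^k. *)
rewrite (partition_big (fun S : {set 'I_n} => inord #|S| : 'I_n.+1)
  (fun k : 'I_n.+1 => (0 < k)%N && (k.*2 <= n)%N)) /=; last first.
  by move=> S; rewrite inordK // ltnS -[leqRHS](card_ord n) max_card.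
apply: (@le_trans _ _ (\sum_(k < n.+1 | (0 < k)%N && (k.*2 <= n)%N) z ^+ k)).
  apply: ler_sum => k /andP[k0 kn].
  apply: le_trans (cut_term_le k0 kn p01 f0 hp).
  rewrite -[X in 'C(X, _)](card_ord n) -card_draws mulrC mulr_natr -sumr_const.
  rewrite le_eqVlt; apply/orP; left; apply/eqP.
  have inordE (S : {set 'I_n}) : (inord #|S| == k) = (#|S| == k :> nat).
    by rewrite -val_eqE /= inordK // ltnS -[leqRHS](card_ord n) max_card.
  apply: eq_big => S; rewrite ?inE inordE.
    by rewrite /P; case: eqP => [->|]; rewrite ?k0 ?kn ?andbF.
  by case/andP => _ /eqP ->.
apply: (@le_trans _ _ (\sum_(k < n.+1 | (0 < k)%N) z ^+ k)).
  rewrite [leLHS]big_mkcondr; apply: ler_sum => k _.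
  by case: ifP => // _; rewrite exprn_ge0 ?ltW.
rewrite big_mkcond big_ord_recl /= add0r.
under eq_bigr => i _ do rewrite /= exprS.
rewrite -mulr_sumr mulrC ler_pM2r //.
(* Since (1 - z) times the geometric sum is 1 - z^n <= 1 and z <= 1/2, the sum is at most 2. *)
have geo := subrX1 z n; have zn : 0 <= z ^+ n by rewrite exprn_ge0 ?ltW.
have S0 : 0 <= \sum_(i < n) z ^+ i.
  by apply: sumr_ge0 => i _; rewrite exprn_ge0 ?ltW.
nra.
Qed.

End ErdosRenyiConnectivity.

(** * Asymptotics *)

Definition block_count (R : realType) (n k : nat) : nat :=
  Num.truncn (n%:R / (k%:R * ln n%:R) : R).

Definition block_size (R : realType) (k : nat) : nat :=
  Num.truncn (Num.sqrt k%:R : R).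

Section Asymptotics.
Variable R : realType.

Lemma half_le_truncn (x : R) : 1 <= x -> x / 2 <= (Num.truncn x)%:R <= x.
Proof.
move=> x1; have x0 : 0 <= x by lra.
have /andP[le_x lt_x] := truncn_itv x0; rewrite le_x andbT.
have t1 : (1 : R) <= (Num.truncn x)%:R by rewrite ler1n truncn_gt0.
by move: lt_x; rewrite -natr1; lra.
Qed.

Lemma inv_subr1_le_expR (p : R) : 0 <= p < 1 -> (1 - p)^-1 <= expR (p / (1 - p)).
Proof.
move=> /andP[p0 p1]; apply: le_trans (expR_ge1Dx _).
rewrite le_eqVlt; apply/orP; left; apply/eqP; field.
by rewrite gt_eqF // subr_gt0.
Qed.

(** [delta] is the inverse of the real number whose integer part is m. The hypotheses give p <=
    delta, so p m stays bounded and the last two terms of the second moment bound are O(delta); the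
    first is O(1 / ln n). *)
Lemma block_colouring_estimate (n k : nat) (p eps : R) :
  let delta := k%:R * ln n%:R / n%:R in
  let m := block_count R n k in
  let t := block_size R k in
  (0 < k)%N -> 0 < eps -> 1 <= ln (n%:R : R) ->
  delta <= 2^-1 -> delta <= eps / 2 -> 0 <= p ->
  p < (1 - eps) * k%:R * (ln (n%:R / Num.sqrt k%:R) / n%:R) ->
  Pr (coloured_random_subset (@block_colour n k m t) p)
     [set G | connected_graph G]%SET
  <= 128 * expR 3 / eps ^+ 2 * (ln n%:R)^-1 + (2 * expR 2 + 2) * delta.
Proof.
move=> delta m t k0 eps0 l1 d2 deps p0 hp.
set l := ln (n%:R : R) in l1 delta d2 deps hp *.
have n1 : (1 < n)%N.
  rewrite ltnNge; apply/negP => h; have : l <= 0 by rewrite ln_le0 ?lern1.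
  lra.
have nR0 : (0 : R) < n%:R by rewrite ltr0n; lia.
have kR1 : (1 : R) <= k%:R by rewrite ler1n.
have kR0 : (0 : R) < k%:R by lra.
set s := Num.sqrt (k%:R : R) in hp.
have s1 : 1 <= s by rewrite /s -[leLHS](@sqrtr1 R) ler_wsqrtr.
have ss : s * s = k%:R by rewrite -expr2 sqr_sqrtr // ltW.
have l0 : 0 < l by lra.
have delta0 : 0 < delta by rewrite /delta divr_gt0 ?mulr_gt0.
have deltan : delta * n%:R = k%:R * l by rewrite /delta divfK ?gt_eqF.
have kn : k%:R <= n%:R :> R by nra.
set La := ln (n%:R / s) in hp.
have LaE : La = l - ln s by rewrite /La ln_div ?posrE //; lra.
have lns0 : 0 <= ln s by exact: ln_ge0.
(* As s^2 = k <= n, the quantity [La] is at least l/2. *)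
have lns : ln s <= l / 2.
  have : ln (s * s) <= l by rewrite ss ler_ln ?posrE.
  by rewrite lnM ?posrE; lra.
have La0 : 0 <= La by lra.
have pn : p * n%:R <= (1 - eps) * k%:R * La.
  by apply: ltW; rewrite -ltr_pdivlMr // -[ltRHS]mulrA.
have pdelta : p <= delta.
  rewrite -(ler_pM2r nR0) deltan; apply: le_trans pn _.
  have : k%:R * La <= k%:R * l by rewrite ler_pM2l //; lra.
  have : 0 <= k%:R * La by rewrite mulr_ge0 // ltW.
  by nra.
have p2 : p <= 2^-1 by lra.
have p01 : 0 <= p < 1 by lra.
have q0 : 0 < 1 - p by lra.
pose p' := p / (1 - p).
have p'q : p' * (1 - p) = p by rewrite /p' divfK ?gt_eqF.
have p'0 : 0 <= p' by rewrite divr_ge0 // ltW.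
have p'2 : p' <= 2 * p by nra.
have zE : (1 - p)^-1 = 1 + p' by rewrite /p'; field; rewrite gt_eqF.
have invdelta : n%:R / (k%:R * l) = delta^-1 by rewrite /delta invf_div.
have invd2 : 2 <= delta^-1 by rewrite -[2]invrK lef_pV2 ?posrE //; lra.
have /andP[m_ge m_le] : delta^-1 / 2 <= m%:R <= delta^-1.
  by rewrite /m /block_count -/l invdelta; apply: half_le_truncn; lra.
have /andP[t_ge t_le] : s / 2 <= t%:R <= s by exact: half_le_truncn.
(* [lra] would otherwise try to evaluate [m] in exponents. *)
clearbody m t.
have m0 : (0 < m)%N by rewrite -(ltr0n R); lra.
have t0 : (0 < t)%N by rewrite -(ltr0n R); lra.
have tk : (t * t <= k)%N.
  by rewrite -(ler_nat R) natrM -ss; apply: ler_pM => //; lra.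
have dK : delta * delta^-1 = 1 by rewrite divff ?gt_eqF.
have mtn : (m * t <= n)%N.
  rewrite -(ler_nat R) natrM; apply: le_trans (_ : delta^-1 * s <= _).
    by apply: ler_pM; rewrite ?ler0n.
  rewrite -invdelta -mulrA ler_piMr //.
  rewrite mulrC ler_pdivrMr ?mulr_gt0 // mul1r.
  by have : s <= k%:R; nra.
apply: le_trans (Pr_connected_block_colour k0 t0 m0 mtn n1 p01) _.
set r := (n %/ k).+1.
have z_le : (1 - p)^-1 <= expR p' by exact: inv_subr1_le_expR.
have zX a : (1 - p)^-1 ^+ a <= expR (p' * a%:R).
  by rewrite expRM_natr lerXn2r ?nnegrE ?expR_ge0 ?invr_ge0 // ltW.
have mp' : p' * m%:R <= 2.
  apply: le_trans (_ : (2 * delta) * delta^-1 <= _); last by rewrite -mulrA dK mulr1.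
  by apply: ler_pM => //; lra.
have part2 : (1 - p)^-1 ^+ m / m%:R <= 2 * expR 2 * delta.
  rewrite [leRHS]mulrAC [leRHS]mulrC; apply: ler_pM.
  - by rewrite exprn_ge0 ?invr_ge0 // ltW.
  - by rewrite invr_ge0 ler0n.
  - by apply: le_trans (zX m) _; rewrite ler_expR.
  have delta20 : 0 < 2 * delta by lra.
  rewrite -[leRHS]invrK lef_pV2 ?posrE ?ltr0n ?(invr_gt0 (2 * delta)) //.
  by rewrite invfM mulrC.
have part3 : (1 - p)^-1 - 1 <= 2 * delta by rewrite zE; lra.
(* The division by 1 - p costs half of eps: 1 - eps <= (1 - eps/2)(1 - p) because p <= delta <=
   eps/2. *)
have rp' : p' * r%:R <= 1 + (1 - eps / 2) * La.
  have r_le : r%:R <= n%:R / k%:R + 1 :> R.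
    rewrite /r -natr1 lerD2r ler_pdivlMr // -natrM ler_nat; exact: leq_trunc_div.
  apply: le_trans (ler_wpM2l p'0 r_le) _.
  rewrite mulrDr mulr1 addrC; apply: lerD; first lra.
  rewrite -(ler_pM2r q0) mulrAC p'q mulrA ler_pdivrMr //.
  apply: le_trans pn _.
  rewrite mulrAC ler_pM2r // mulrAC ler_wpM2r //; nra.
clearbody r.
(* The quotient is at most 4 l e^3 exp(-(eps/4) l). With e^y >= y^2/2 for y = (eps/4) l, the
   constant is 4 * 2 * 16 = 128. *)
have part1 : (1 - p)^-1 ^+ (m + r) / (m * t)%:R <= 128 * expR 3 / eps ^+ 2 * l^-1.
  have mt_ge : expR La / (4 * l) <= (m * t)%:R.
    rewrite natrM lnK ?posrE ?divr_gt0 //; last by lra.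
    apply: le_trans (_ : (delta^-1 / 2) * (s / 2) <= _).
      rewrite -invdelta -ss le_eqVlt; apply/orP; left; apply/eqP.
      by field; rewrite !gt_eqF //; lra.
    by apply: ler_pM => //; lra.
  have mt0 : (0 : R) < (m * t)%:R by rewrite ltr0n muln_gt0 m0.
  rewrite ler_pdivrMr //.
  apply: le_trans (zX _) _.
  apply: le_trans (_ : expR (3 + La - eps / 4 * l) <= _).
    rewrite ler_expR natrD mulrDr.
    have : eps / 4 * l <= eps / 2 * La by nra.
    by lra.
  rewrite (expRD (3 + La)) (expRD 3) expRN.
  have y2 : (eps / 4 * l) ^+ 2 / 2 <= expR (eps / 4 * l).
    have y0 : 0 <= eps / 4 * l by rewrite mulr_ge0; lra.
    apply: le_trans (expR_ge1Dxn 1 y0); rewrite [in leRHS](_ : 2`! = 2)%N //.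
    by rewrite lerDr.
  have y20 : 0 < (eps / 4 * l) ^+ 2 / 2.
    by rewrite divr_gt0 ?exprn_gt0 ?mulr_gt0 //; lra.
  apply: le_trans (_ : expR 3 * expR La * ((eps / 4 * l) ^+ 2 / 2)^-1 <= _).
    by rewrite ler_pM2l ?mulr_gt0 ?expR_gt0 // lef_pV2 ?posrE ?expR_gt0.
  apply: le_trans (_ : 128 * expR 3 / eps ^+ 2 * l^-1 * (expR La / (4 * l)) <= _).
    rewrite le_eqVlt; apply/orP; left; apply/eqP.
    by field; rewrite !gt_eqF.
  rewrite ler_pM2l //.
  by rewrite !(mulr_gt0, invr_gt0) ?expR_gt0 ?exprn_gt0.
rewrite [leRHS](_ : _ = 128 * expR 3 / eps ^+ 2 * l^-1 + 2 * expR 2 * delta + 2 * delta);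
  last by ring.
by apply: lerD part3; apply: lerD part1 part2.
Qed.

End Asymptotics.

(** * Passage to the limit and the theorem *)

Lemma Pr_setC (R : realType) (T : finType) (mu : T -> R) (P : pred T) :
  is_distribution mu ->
  Pr mu [set w | P w]%SET = 1 - Pr mu [set w | ~~ P w]%SET.
Proof.
move=> [_ mu1]; apply/eqP; rewrite eq_sym subr_eq -mu1 (bigID P) /=.
by apply/eqP; congr (_ + _); apply: eq_bigl => w; rewrite inE.
Qed.

Local Open Scope classical_set_scope.

Lemma almost_surely_small_compl (R : realType) (mu : forall n, sgraph 'I_n -> R)
    (P : forall n, pred (sgraph 'I_n)) :
  (forall n, is_distribution (mu n)) ->
  (forall e : R, 0 < e ->
     \forall n \near \oo, Pr (mu n) [set G | ~~ P n G]%SET <= e) ->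
  almost_surely mu (fun n => [set G | P n G]%SET).
Proof.
move=> hmu small; apply/cvgrPdist_le => e /small; apply: filterS => n.
rewrite /= (Pr_setC (P n) (hmu n)) opprB addrC subrK ger0_norm //.
by apply: sumr_ge0 => G _; case: (hmu n).
Qed.

Lemma near_le_ln (R : realType) (A : R) : \forall n \near \oo, A <= ln (n%:R : R).
Proof.
apply: filterS (nbhs_infty_ger (expR A)) => n h.
by rewrite -ler_expR lnK // posrE (lt_le_trans (expR_gt0 A)).
Qed.

(** From n = e^l >= l^2/2. This controls the extra ln n / n when d is replaced by d + 1. *)
Lemma ln_div_le (R : realType) (n : nat) :
  1 <= ln (n%:R : R) -> ln n%:R / n%:R <= 2 * (ln n%:R)^-1 :> R.
Proof.
set l := ln _ => l1.
have n0 : (0 : R) < n%:R.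
  (* [ln] takes the value 0 on non-positive reals, which contradicts 1 <= l. *)
  rewrite ltNge; apply/negP => h; have : l = 0 by exact: ln0.
  lra.
rewrite ler_pdivrMr // mulrAC ler_pdivlMr; last by lra.
have := @expR_ge1Dxn R l 1 (le_trans ler01 l1).
rewrite lnK ?posrE // [2`!](_ : _ = 2)%N // expr2; lra.
Qed.

Local Open Scope ring_scope.

Theorem theorem6 (R : realType) (d : nat -> nat) (p : nat -> R)
    (hp : forall n, 0 <= p n <= 1) :
  (exists mu : forall n, sgraph 'I_n -> R,
     (forall n, dependent_random_graph (p n) (d n) (mu n)) /\
     (forall eps : R, 0 < eps ->
        (\forall n \near \oo,
           p n < (1 - eps) * (d n + 1)%:R *
                 (ln (n%:R / Num.sqrt (d n + 1)%:R) / n%:R)) ->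
        (d n)%:R * ln n%:R / n%:R @[n --> \oo] --> (0 : R) ->
        almost_surely mu (fun n => [set G | ~~ connected_graph G]%SET)))
  /\
  ((forall n, dependent_random_graph (p n) (d n) (@erdos_renyi R n (p n))) /\
   (forall f : nat -> R,
      f n @[n --> \oo] --> +oo ->
      (\forall n \near \oo, p n > (ln n%:R + f n) / n%:R) ->
      almost_surely (fun n => @erdos_renyi R n (p n))
        (fun n => [set G | connected_graph G]%SET))).
Proof.
split.
  pose mu n := coloured_random_subset
    (@block_colour n (d n + 1) (block_count R n (d n + 1)) (block_size R (d n + 1)))
    (p n).
  have sqrt_ge1 n : 1 <= Num.sqrt (d n + 1)%:R :> R.
    by rewrite -[leLHS](@sqrtr1 R) ler_wsqrtr // ler1n addn1.
  have hmu n : dependent_random_graph (p n) (d n) (mu n).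
    apply: coloured_dependent_random_graph => // l; rewrite -(addn1 (d n)).
    have /andP[_ t_le] := half_le_truncn (sqrt_ge1 n).
    apply: card_block_colour; first by rewrite truncn_gt0.
    rewrite -(ler_nat R) natrM -[leRHS]sqr_sqrtr ?ler0n // expr2.
    by apply: ler_pM; rewrite ?ler0n.
  exists mu; split=> // eps eps0 hlt hd.
  apply: almost_surely_small_compl => [n|e e0]; first by case: (hmu n).
  pose b : R := 128 * expR 3 / eps ^+ 2.
  pose c : R := 2 * expR 2 + 2.
  have b0 : 0 < b by rewrite /b !(mulr_gt0, invr_gt0) ?expR_gt0 ?exprn_gt0.
  have c0 : 0 < c by rewrite /c addr_gt0 ?mulr_gt0 ?expR_gt0.
  (* The first two bounds are the hypotheses on [delta] in the estimate; the third gives c * delta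
     <= e/2. *)
  pose x : R := Num.min (Num.min 2^-1 (eps / 2)) (e / (2 * c)).
  have x0 : 0 < x by rewrite !lt_min invr_gt0 ltr0n !divr_gt0 ?mulr_gt0.
  near=> n.
  set delta : R := (d n + 1)%:R * ln n%:R / n%:R.
  have l1 : 1 <= ln (n%:R : R) by near: n; exact: near_le_ln.
  (* This makes ln n / n <= 2 / ln n <= x/2, the share of the [+ 1] in d + 1. *)
  have l4 : 4 / x <= ln (n%:R : R) by near: n; exact: near_le_ln.
  have lb : (2 * b) / e <= ln (n%:R : R) by near: n; exact: near_le_ln.
  have l0 : 0 < ln (n%:R : R) by lra.
  have dx : (d n)%:R * ln n%:R / n%:R <= x / 2.
    by near: n; apply: (cvgr_le _ hd); rewrite divr_gt0.
  have delta_x : delta <= x.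
    have := ln_div_le l1.
    have : 2 * (ln n%:R)^-1 <= x / 2.
      rewrite ler_pdivrMr //; move: l4; rewrite ler_pdivrMr //.
      by lra.
    by rewrite /delta natrD mulrDl mulrDl mul1r; lra.
  move: delta_x; rewrite /x !le_min => /andP[/andP[d2 deps] de].
  under [X in Pr _ X]finset.eq_finset => G do rewrite negbK.
  apply: le_trans (block_colouring_estimate _ eps0 l1 d2 deps _ _) _.
  - by rewrite addn1.
  - by case/andP: (hp n).
  - by near: n.
  rewrite -/b -/c -/delta.
  have : b * (ln n%:R)^-1 <= e / 2.
    by rewrite ler_pdivrMr //; move: lb; rewrite ler_pdivrMr //; lra.
  have : c * delta <= e / 2.
    by move: de; rewrite ler_pdivlMr ?mulr_gt0 //; lra.
  by lra.
have hmu n : dependent_random_graph (p n) (d n) (@erdos_renyi R n (p n)).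
  have <- : coloured_random_subset id (p n) = @erdos_renyi R n (p n).
    by apply/funext => G; exact: erdos_renyiE.
  apply: coloured_dependent_random_graph => // l.
  rewrite (_ : [set e | _]%SET = [set l]%SET) ?cards1 //.
  by apply/setP => e; rewrite !inE.
split=> // f hf hlt.
apply: almost_surely_small_compl => [n|e e0]; first by case: (hmu n).
(* The bound 1/2 is needed for the geometric series, and e/2 makes its value 2z at most e. *)
pose x : R := Num.min 2^-1 (e / 2).
have x0 : 0 < x by rewrite lt_min divr_gt0 // invr_gt0 ltr0n.
near=> n.
have n0 : (0 : R) < n%:R by rewrite ltr0n; near: n; exact: nbhs_infty_gt.
have f0 : 0 <= f n by near: n; apply: (cvgryPge _).1.
(* Equivalent to 2 - f/2 <= ln x. *)
have fx : 2 * (2 - ln x) <= f n by near: n; apply: (cvgryPge _).1.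
have zx : expR (2 - f n / 2) <= x.
  by rewrite -[leRHS]lnK ?posrE // ler_expR; lra.
move: zx; rewrite le_min => /andP[z2 ze].
apply: le_trans (Pr_disconnected_erdos_renyi (hp n) f0 _ z2) _; last by lra.
rewrite -ler_pdivrMr // ltW //.
by near: n.
Unshelve. all: by end_near. Qed.
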